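(* For every $k \in \{1,2,3,4,5\}$ we have $\mathrm{minvdeg}(\mathcal{MU}_{\delta=k}) = \mathrm{minvdeg}(\mathcal{UHIT}_{\delta=k}) = \mathrm{N}(k)$.
   Context: Literals come with a fixed-point-free involution $x \mapsto \overline{x}$; variables are positive literals. A clause is a finite set $C$ of literals with $C \cap \overline{C} = \emptyset$; a clause-set is a finite set of clauses. $\mathrm{var}(F)$, $n(F) = |\mathrm{var}(F)|$, $c(F) = |F|$, $\delta(F) = c(F) - n(F)$. $\mathcal{MU}$ is the class of minimally unsatisfiable clause-sets (unsatisfiable, but removing any clause gives a satisfiable clause-set). $F$ is hitting if for all distinct $C, D \in F$, $C \cap \overline{D} \ne \emptyset$; $\mathcal{UHIT}$ is the class of unsatisfiable hitting clause-sets. $\mathcal{C}_{\delta=k} = \{F \in \mathcal{C} : \delta(F) = k\}$. $\mathrm{ld}_F(x)$ is the number of clauses containing $x$, $\mathrm{vdeg}_F(v) = \mathrm{ld}_F(v)+\mathrm{ld}_F(\overline{v})$, $\mathrm{minvdeg}(F) = \min_{v \in \mathrm{var}(F)} \mathrm{vdeg}_F(v)$; for a class $\mathcal{D}$, $\mathrm{minvdeg}(\mathcal{D})$ is the supremum of $\mathrm{minvdeg}(F)$ over $F \in \mathcal{D}$ with $n(F) > 0$. $\mathrm{N}(1) = 2$, $\mathrm{N}(k) = \max_{i \in \{2,\dots,k\}} \min(2i, \mathrm{N}(k-i+1)+i)$ for $k \ge 2$. *)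

(* Defs.v *)
From HB Require Import structures.
From mathcomp Require Import all_boot all_order all_algebra.
From mathcomp Require Import finmap.
Set Implicit Arguments. Unset Strict Implicit. Unset Printing Implicit Defensive.
Local Open Scope fset_scope.

(* Literals: (v, true) is the positive literal (the variable v), (v, false) its negation. *)
Definition lit := (nat * bool)%type.
Definition compl (x : lit) : lit := (x.1, ~~ x.2).
Definition clause := {fset lit}.
Definition cls := {fset clause}.

Definition wf_cls (F : cls) : Prop :=
  forall C, C \in F -> forall x, x \in C -> compl x \notin C.

Definition sat_clause (phi : nat -> bool) (C : clause) : bool :=
  [exists x : C, phi (val x).1 == (val x).2].
Definition satisfiable (F : cls) : Prop :=
  exists phi : nat -> bool, forall C, C \in F -> sat_clause phi C.

Definition MU (F : cls) : Prop :=
  wf_cls F /\ ~ satisfiable F /\ (forall C, C \in F -> satisfiable (F `\ C)).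

Definition hitting (F : cls) : Prop :=
  forall C D, C \in F -> D \in F -> C != D -> exists2 x, x \in C & compl x \in D.

Definition UHIT (F : cls) : Prop := wf_cls F /\ ~ satisfiable F /\ hitting F.

Definition vars (F : cls) : {fset nat} := \bigcup_(C <- F) [fset x.1 | x in C].
Definition nvar (F : cls) : nat := #|` vars F|.
Definition ncl (F : cls) : nat := #|` F|.
Definition delta (F : cls) : int := (ncl F)%:Z - (nvar F)%:Z.

Definition ld (F : cls) (x : lit) : nat := #|` [fset C in F | x \in C]|.
Definition vdeg (F : cls) (v : nat) : nat := ld F (v, true) + ld F (v, false).
Definition minvdeg (F : cls) : nat :=
  match enum_fset (vars F) with
  | [::] => 0
  | v :: s => foldr (fun w m => minn (vdeg F w) m) (vdeg F v) s
  end.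

Definition nat_sup (P : nat -> Prop) (m : nat) : Prop :=
  (forall x, P x -> x <= m) /\ (forall u, (forall x, P x -> x <= u) -> m <= u).

Definition minvdeg_class_is (D : cls -> Prop) (m : nat) : Prop :=
  nat_sup (fun x => exists F, D F /\ 0 < nvar F /\ x = minvdeg F) m.

Fixpoint Naux (fuel k : nat) : nat :=
  match fuel with
  | 0 => 2
  | fuel'.+1 => if k <= 1 then 2
                else \max_(2 <= i < k.+1) minn (2 * i) (Naux fuel' (k - i + 1) + i)
  end.
Definition N (k : nat) : nat := Naux k k.

(* Main.v *)
(** Upper bound, by induction on the number of variables: adding literals to
    clauses of a minimally unsatisfiable F as long as it stays unsatisfiable
    changes neither the variables nor the deficiency and only raises degrees,
    so F may be assumed saturated.  Then setting a literal x to true yields a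
    minimally unsatisfiable clause-set, and if the variable v of x has minimal
    degree, no variable other than v disappears, so that the deficiency drops
    from k to k - ld(x) + 1.  As deficiencies are positive, ld(x) <= k.  With
    i = ld(x) the larger of the two literal degrees of v, either v has degree
    at most 2i, or a variable of degree at most N(k-i+1) after the assignment
    has degree at most N(k-i+1) + i in F.

    Lower bound: partitions of the Boolean cube of dimension at most 3 into
    vertices and edges give unsatisfiable hitting clause-sets attaining N(k). *)

Require Import Defs.
From HB Require Import structures.
From mathcomp Require Import all_boot all_order all_algebra.
From mathcomp Require Import finmap.
From mathcomp Require Import zify.
From Stdlib Require Import Classical.
Set Implicit Arguments. Unset Strict Implicit. Unset Printing Implicit Defensive.
Local Open Scope fset_scope.
Local Open Scope nat_scope.

(** * Literals, satisfaction and variable degrees *)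

Lemma complK : involutive compl.
Proof. by case=> v b; rewrite /compl /= negbK. Qed.

Lemma compl_neq x : compl x != x.
Proof. by case: x => v []; apply/eqP. Qed.

Lemma eq_var_compl (x y : lit) : x.1 = y.1 -> x = y \/ x = compl y.
Proof. by case: x y => [v []] [w []] /= ->; [left|right|right|left]. Qed.

Lemma sat_clauseP phi (C : clause) :
  reflect (exists2 x, x \in C & phi x.1 = x.2) (sat_clause phi C).
Proof.
apply: (iffP existsP) => [[x /eqP]|[x xC /eqP]].
  by exists (val x) => //; apply: valP.
by exists [` xC].
Qed.

Lemma sat_clause_sub phi (C D : clause) :
  C `<=` D -> sat_clause phi C -> sat_clause phi D.
Proof.
by move=> /fsubsetP CD /sat_clauseP[x /CD xD e]; apply/sat_clauseP; exists x.
Qed.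

Lemma varsP (F : cls) v :
  reflect (exists2 C, C \in F & exists b, (v, b) \in C) (v \in vars F).
Proof.
apply: (iffP (bigfcupP _ _ _ _)) => [[C /andP[CF _]]|[C CF [b vC]]].
  by case/imfsetP=> -[w b] /= wC ->; exists C => //; exists b.
by exists C; rewrite ?CF //; apply/imfsetP; exists (v, b).
Qed.

Lemma ld_sum F x : ld F x = \sum_(C <- F) (x \in C).
Proof.
by rewrite /ld card_fset_sum1 -big_fset_condE big_mkcond; apply: eq_bigr => C _; case: ifP.
Qed.

Lemma vdeg_sum F v :
  vdeg F v = \sum_(C <- F) (((v, true) \in C) + ((v, false) \in C)).
Proof. by rewrite /vdeg !ld_sum big_split. Qed.

Lemma vdegE F (x : lit) : vdeg F x.1 = ld F x + ld F (compl x).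
Proof. by case: x => v [] //; rewrite addnC. Qed.

Lemma minvdeg_le F v : v \in vars F -> minvdeg F <= vdeg F v.
Proof.
rewrite /minvdeg -[v \in _]/(v \in enum_fset (vars F)).
case: (enum_fset _) => // w s; rewrite in_cons => /predU1P[->|].
  by elim: s => //= u s /(leq_trans (geq_minr _ _)).
elim: s => //= u s IH; rewrite in_cons => /predU1P[->|/IH h]; first exact: geq_minl.
exact: leq_trans (geq_minr _ _) h.
Qed.

Lemma minvdeg_attained F : 0 < nvar F ->
  exists2 v, v \in vars F & minvdeg F = vdeg F v.
Proof.
rewrite /nvar /minvdeg => n0.
suff [v vs ->] : exists2 v, v \in enum_fset (vars F) &
  match enum_fset (vars F) with
  | [::] => 0
  | v :: s => foldr (fun w m => minn (vdeg F w) m) (vdeg F v) s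
  end = vdeg F v by exists v.
case: (enum_fset _) n0 => // w s _.
elim: s => [|u s [v vs e]] /=; first by exists w; rewrite ?mem_head.
case: leqP => _; first by exists u; rewrite // !in_cons eqxx orbT.
by exists v => //; move: vs; rewrite !in_cons => /orP[->|->]; rewrite ?orbT.
Qed.

(** * Critical assignments of minimally unsatisfiable clause-sets *)

Lemma MU_critical (F : cls) C : MU F -> C \in F ->
  exists phi, ~~ sat_clause phi C /\ forall D, D \in F -> D != C -> sat_clause phi D.
Proof.
move=> [_ [unsat /[apply]]] [phi sF]; exists phi.
have sD D : D \in F -> D != C -> sat_clause phi D.
  by move=> DF neq; apply: sF; rewrite !inE neq.
split=> //; apply/negP=> sC; apply: unsat; exists phi => D DF.
by have [->|/sD] := eqVneq D C; last exact.
Qed.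

(** An assignment falsifying only [D] would satisfy [C], hence also its superset [D]. *)
Lemma MU_subset_eq (F : cls) (C D : clause) : MU F -> C \in F -> D \in F -> C `<=` D -> C = D.
Proof.
move=> MF CF DF CD; apply/eqP; apply/negPn/negP => neq.
have [phi [/negP nD s]] := MU_critical MF DF.
exact/nD/(sat_clause_sub CD)/s.
Qed.

(** Were [compl x] absent, making [x] true in an assignment that falsifies only [C] would satisfy
    [C] and harm no other clause. *)
Lemma MU_compl_occurs (F : cls) (C : clause) x : MU F -> C \in F -> x \in C ->
  exists2 D, D \in F & compl x \in D.
Proof.
move=> MF CF xC; have [phi [nC s]] := MU_critical MF CF.
case: (boolP (has (fun D : clause => compl x \in D) F)) => [/hasP[D]|/hasPn nx].
  by exists D.
case: MF => wf [[]]; exists (fun v => if v == x.1 then x.2 else phi v) => D DF.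
have [->|/(s _ DF)/sat_clauseP[y yD e]] := eqVneq D C; apply/sat_clauseP.
  by exists x; rewrite ?eqxx.
exists y => //; case: eqP => // /eq_var_compl[->//|ey].
by have := nx D DF; rewrite -ey yD.
Qed.

Lemma UHIT_MU F : UHIT F -> MU F.
Proof.
move=> [wf [unsat hit]]; split=> //; split=> // C CF.
(* This falsifies every literal of [C], so a literal of [D] clashing with [C] becomes true. *)
exists (fun v => (v, false) \in C) => D; rewrite !inE => /andP[neq DF].
have [x xD xC] := hit _ _ DF CF neq; apply/sat_clauseP; exists x => //.
case: x xD xC => v [] //= _ vC.
by apply/negP=> vC'; have := wf C CF _ vC; rewrite vC'.
Qed.

(** * Saturation by adding literals *)

(** Only literals over [vars F] are added, so an extension that stays unsatisfiable introduces no
    variable and keeps the deficiency. *)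
Definition saturated (F : cls) := forall (C : clause) y, C \in F -> y \notin C ->
  compl y \notin C -> y.1 \in vars F -> satisfiable ((y |` C) |` (F `\ C)).

Section Extend.
Variables (F : cls) (C : clause) (y : lit).
Hypotheses (MF : MU F) (CF : C \in F) (yC : y \notin C) (cyC : compl y \notin C).
Let F' := (y |` C) |` (F `\ C).
Hypothesis unsat : ~ satisfiable F'.

(** Otherwise [C] would be properly contained in another clause of [F]. Hence the extended clause
    does not merge with an existing one. *)
Lemma extend_notin : y |` C \notin F.
Proof.
apply/negP=> H; move: yC; have := fsubsetU1 y C.
by move/(MU_subset_eq MF CF H)=> ->; rewrite fset1U1.
Qed.

Lemma extend_sum (f : clause -> nat) :
  \sum_(D <- F') f D + f C = \sum_(D <- F) f D + f (y |` C).
Proof.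
rewrite big_fsetU1 /=; last by rewrite !inE negb_and extend_notin orbT.
by rewrite [in RHS](big_fsetD1 C) //=; lia.
Qed.

(** Dropping the new clause leaves part of [F] without [C]. Dropping another clause [D] is harmless
    because an assignment satisfying [C] satisfies its superset. *)
Lemma extend_MU : MU F'.
Proof.
case: (MF) => wf [nsat crit]; split; last split=> //.
  move=> D; rewrite !inE => /orP[/eqP->|/andP[_]]; last exact: wf.
  move=> x; rewrite !inE negb_or => /predU1P[->|xC]; first by rewrite compl_neq.
  rewrite (wf C CF) // andbT; apply: contraNneq cyC => <-.
  by rewrite complK.
move=> D; rewrite in_fset1U => /predU1P[->|].
  have [phi s] := crit C CF; exists phi => E; rewrite !inE => /andP[/negbTE->].
  by move=> /= EF; apply: s; rewrite !inE.
rewrite !inE => /andP[neq DF]; have [phi s] := crit D DF.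
exists phi => E; rewrite !inE => /andP[nED /predU1P[->|/andP[_ EF]]].
  by apply: (@sat_clause_sub _ C); rewrite ?fsubsetU1 ?s // !inE eq_sym neq.
by apply: s; rewrite !inE nED.
Qed.

Lemma extend_vars : y.1 \in vars F -> vars F' = vars F.
Proof.
move=> yF; apply/fsetP=> v; apply/varsP/varsP => -[D].
  rewrite !inE => /predU1P[->|/andP[_ DF]]; last by exists D.
  case=> b; rewrite !inE => /predU1P[e|]; last by exists C => //; exists b.
  by apply/varsP; rewrite -[v]/((v, b).1) e.
move=> DF [b vD]; have [e|neq] := eqVneq D C; last first.
  by exists D; [rewrite !inE neq DF orbT | exists b].
by exists (y |` C); [rewrite fset1U1 | exists b; rewrite fset1Ur -?e].
Qed.

Lemma extend_ncl : ncl F' = ncl F.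
Proof.
by apply: (@addIn 1); rewrite /ncl !card_fset_sum1 (extend_sum (fun=> 1)).
Qed.

Lemma extend_vdeg v : vdeg F v <= vdeg F' v.
Proof.
rewrite !vdeg_sum; have := extend_sum (fun D => ((v, true) \in D) + ((v, false) \in D)).
rewrite /= !in_fset1U.
by case: (_ \in C); case: (_ \in C); case: (_ == y); case: (_ == y) => /=; lia.
Qed.

Lemma extend_size :
  \sum_(D <- F') #|` D| = (\sum_(D <- F) #|` D|).+1.
Proof.
by have := extend_sum (fun D => #|` D|); rewrite cardfsU1 yC; lia.
Qed.

End Extend.

(** A clause has no complementary pair, so its literals have distinct variables. *)
Lemma wf_cls_size F : wf_cls F -> \sum_(C <- F) #|` C| <= ncl F * nvar F.
Proof.
move=> wf; rewrite /ncl card_fset_sum1 big_distrl /= !big_seq.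
apply: leq_sum => C CF; rewrite mul1n.
rewrite -(@card_in_imfset imfset_key _ _ (fun x : lit => x.1) (mem C)) /=; last first.
  move=> x y xC yC /eq_var_compl[//|e].
  by have := wf C CF y yC; rewrite -e xC.
apply: fsubset_leq_card; apply/fsubsetP=> v /imfsetP[[w b] /= wC ->].
by apply/varsP; exists C => //; exists b.
Qed.

Lemma MU_saturate F : MU F -> exists F',
  [/\ MU F', saturated F', vars F' = vars F, ncl F' = ncl F
    & forall v, vdeg F v <= vdeg F' v].
Proof.
(* Each extension adds one literal occurrence, while the bound [ncl F * nvar F] stays fixed; the gap
   therefore decreases. *)
have [m] := ubnP (ncl F * nvar F - \sum_(C <- F) #|` C|).
elim: m F => // m IH F le MF.
have [sat|/not_all_ex_not[C /not_all_ex_not[y]]] := classic (saturated F).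
  by exists F.
move=> nsat; have [CF [yC [cyC [yF unsat]]]] : C \in F /\ y \notin C /\ compl y \notin C
    /\ y.1 \in vars F /\ ~ satisfiable ((y |` C) |` (F `\ C)) by tauto.
have MF' := extend_MU MF CF cyC unsat.
have vF' := extend_vars CF yF.
have nF' := extend_ncl MF CF yC cyC.
have sF' := extend_size MF CF yC cyC.
have bound := wf_cls_size (proj1 MF'); rewrite nF' /nvar vF' sF' -/(nvar F) in bound.
case: (IH _ _ MF'); first by rewrite nF' /nvar vF' sF' -/(nvar F); lia.
move=> G [MG satG vG nG dG]; exists G; rewrite vG nG; split=> // v.
exact: leq_trans (extend_vdeg MF CF yC cyC v) (dG v).
Qed.

(** * Setting a literal to true *)

Definition assign (F : cls) (x : lit) : cls :=
  [fset C `\ compl x | C in [fset C in F | x \notin C]].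

Section Assign.
Variables (F : cls) (x : lit).
Hypotheses (MF : MU F) (xF : x.1 \in vars F).

Lemma assignP D :
  reflect (exists2 C, C \in F /\ x \notin C & D = C `\ compl x) (D \in assign F x).
Proof.
apply: (iffP (imfsetP _ _ _ _)) => [[C]|[C [CF xC] ->]].
  by rewrite !inE => /andP[CF xC] ->; exists C.
by exists C => //; rewrite !inE CF.
Qed.

(** If exactly one of the two clauses contained [compl x], it would include the other. So no clauses
    merge under the assignment. *)
Lemma assign_inj (C D : clause) :
  C \in F -> D \in F -> C `\ compl x = D `\ compl x -> C = D.
Proof.
move=> CF DF e; case: (boolP (compl x \in C)) => xC; last first.
  by apply: (MU_subset_eq MF) => //; rewrite -(mem_fsetD1 xC) e fsubD1set.
case: (boolP (compl x \in D)) => xD; first by rewrite -(fsetD1K xC) e fsetD1K.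
by apply/esym/(MU_subset_eq MF) => //; rewrite -(mem_fsetD1 xD) -e fsubD1set.
Qed.

Lemma assign_sum (f : clause -> nat) :
  \sum_(D <- assign F x) f D = \sum_(C <- F | x \notin C) f (C `\ compl x).
Proof.
rewrite big_imfset /= -?big_fset_condE // => C D.
by rewrite !inE => /andP[CF _] /andP[DF _]; apply: assign_inj.
Qed.

Lemma assign_ncl : ncl (assign F x) + ld F x = ncl F.
Proof.
rewrite /ncl !card_fset_sum1 assign_sum ld_sum [RHS](bigID (fun C : clause => x \in C)) /=.
rewrite addnC; congr (_ + _); rewrite [RHS]big_mkcond.
by apply: eq_bigr => C _; case: ifP.
Qed.

Lemma sum_vdeg_clause (C : clause) w : C \in F ->
  ((w, true) \in C) + ((w, false) \in C) <= 1.
Proof.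
case: MF => wf _ CF; case: (boolP (_ \in C)) => [/(wf C CF)|_]; last by case: (_ \in C).
by rewrite /compl /= => /negbTE->.
Qed.

(** Occurrences of [w] are lost only in clauses containing [x], at most one in each. *)
Lemma assign_vdeg w : w != x.1 -> vdeg F w <= vdeg (assign F x) w + ld F x.
Proof.
move=> neq; rewrite !vdeg_sum assign_sum ld_sum (bigID (fun C : clause => x \in C)) /=.
rewrite addnC leq_add //.
  apply/eq_leq/eq_bigr => C _; rewrite !inE.
  by rewrite /compl !xpair_eqE (negbTE neq).
rewrite big_mkcond !big_seq; apply: leq_sum => C CF; case: ifP => // _.
exact: sum_vdeg_clause.
Qed.

Lemma assign_MU : saturated F -> MU (assign F x).
Proof.
move=> satF; case: (MF) => wf [unsat crit]; split; last split.
- move=> D /assignP[C [CF xC] ->] y; rewrite !inE => /andP[_ yC].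
  by rewrite (negbTE (wf C CF y yC)) andbF.
(* A satisfying assignment lifts to [F] by making [x] true. *)
- case=> phi s; apply: unsat; exists (fun v => if v == x.1 then x.2 else phi v) => C CF.
  apply/sat_clauseP; case: (boolP (x \in C)) => xC; first by exists x; rewrite ?eqxx.
  have /s/sat_clauseP[y] : C `\ compl x \in assign F x by apply/assignP; exists C.
  rewrite !inE => /andP[yx yC] e; exists y => //; case: eqP => // /eq_var_compl[->//|ey].
  by rewrite ey eqxx in yx.
move=> D' /assignP[C [CF xC] ->].
(* It suffices to satisfy all clauses of [F] but [C] with [x] true: such an assignment makes
   [compl x] false, so deleting [compl x] does no harm. *)
suff [phi px s] : exists2 phi : nat -> bool, phi x.1 = x.2 &
    forall D, D \in F -> D != C -> sat_clause phi D.
  exists phi => D; rewrite in_fsetD1 => /andP[neq /assignP[E [EF xE] eD]].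
  have /sat_clauseP[y yE e] : sat_clause phi E.
    by apply: s => //; apply: contraNneq neq => <-; rewrite eD.
  apply/sat_clauseP; exists y => //; rewrite eD !inE yE andbT.
  by apply/eqP => ey; move: e; rewrite ey /= px; case: (x.2).
case: (boolP (compl x \in C)) => cxC.
  (* Falsifying [C] falsifies [compl x], so [x] is true. *)
  have [phi [nC s]] := MU_critical MF CF; exists phi => //.
  apply/eqP; case: eqP => // ne; case/negP: nC; apply/sat_clauseP.
  by exists (compl x) => //=; move: ne; case: (phi _); case: (x.2).
have [phi s] := satF C x CF xC cxC xF.
have sD D : D \in F -> D != C -> sat_clause phi D.
  by move=> DF neq; apply: s; rewrite !inE neq DF orbT.
exists phi => //.
have /s/sat_clauseP[y] : x |` C \in (x |` C) |` (F `\ C) by rewrite fset1U1.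
rewrite in_fset1U => /predU1P[->//|yC e]; case: unsat; exists phi => D DF.
have [->|/sD] := eqVneq D C; last exact.
by apply/sat_clauseP; exists y.
Qed.

Lemma ld_gt0 (C : clause) y : C \in F -> y \in C -> 0 < ld F y.
Proof.
by move=> CF yC; rewrite ld_sum (big_fsetD1 C) //= yC.
Qed.

Lemma vars_ld_gt0 : 0 < ld F x.
Proof.
have /varsP[C CF [b xC]] := xF.
have [e|e] : x = (x.1, b) \/ x = compl (x.1, b) by apply: eq_var_compl.
  by rewrite e; apply: ld_gt0 xC.
by have [D DF xD] := MU_compl_occurs MF CF xC; rewrite e; apply: ld_gt0 xD.
Qed.

End Assign.

(** A vanished variable [w] occurs only in clauses containing [x], so its degree is at most
    [ld F x]. That is less than the degree of [x.1], since [compl x] occurs too. *)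
Lemma assign_vars (F : cls) x : MU F -> x.1 \in vars F ->
  (forall w, w \in vars F -> vdeg F x.1 <= vdeg F w) ->
  vars (assign F x) = vars F `\ x.1.
Proof.
move=> MF xF min; apply/fsetP=> w; rewrite in_fsetD1; apply/varsP/andP.
  case=> D /assignP[C [CF xC] ->] [b]; rewrite !inE => /andP[neq wC]; split.
    apply: contraNneq xC => ew; have [<-//|e] : (w, b) = x \/ (w, b) = compl x.
      exact: eq_var_compl.
    by rewrite e eqxx in neq.
  by apply/varsP; exists C => //; exists b.
case=> neq wF.
have [/hasP[C CF /andP[xC /orP wC]]|/hasPn no] := boolP (has (fun C : clause =>
   (x \notin C) && (((w, true) \in C) || ((w, false) \in C))) F).
  exists (C `\ compl x); first by apply/assignP; exists C.
  have ne b : (w, b) != compl x by apply: contraNneq neq => /(congr1 fst)/= ->.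
  by case: wC => wC; [exists true | exists false]; rewrite in_fsetD1 ne wC.
suff : vdeg F w <= ld F x.
  move=> le; have := min w wF.
  have := @vars_ld_gt0 _ (compl x) MF xF; rewrite vdegE; lia.
rewrite vdeg_sum ld_sum !big_seq; apply: leq_sum => C CF.
have := no C CF; case: (x \in C) => [_|] /=; first exact: (sum_vdeg_clause MF w CF).
by rewrite negb_or => /andP[/negbTE-> /negbTE->].
Qed.

(** * The recursion for [N] *)

(** Fuel [k] suffices: as [i] is at least 2, each recursive argument [k - i + 1] is smaller than
    [k]. *)
Lemma Naux_fuel f g k : k <= f -> k <= g -> Naux f k = Naux g k.
Proof.
elim: f g k => [|f IH] [|g] k //=; try by case: k.
move=> kf kg; case: ifP => // k1; rewrite !big_nat.
by apply: eq_bigr => i /andP[i2 ik]; rewrite (IH g) //; lia.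
Qed.

Lemma N_ge k i : 2 <= i <= k -> minn (2 * i) (N (k - i + 1) + i) <= N k.
Proof.
case: k => [|k] /andP[i2 ik]; first lia.
rewrite [N k.+1]/N /=; case: ifP => k1; first lia.
rewrite /N (@Naux_fuel _ k) //; last by lia.
pose g j := minn (2 * j) (Naux k (k.+1 - j + 1) + j).
by apply: (@leq_bigmax_seq _ _ xpredT g i); rewrite ?mem_index_iota ?i2.
Qed.

(** This covers a literal degree of 1, which lies outside the range of the maximum. *)
Lemma N_ge2 k : 2 <= N k.
Proof.
have [|k2] := leqP k 1; first by case: k => [|[]].
by apply: leq_trans (@N_ge k k _); rewrite ?k2 //; lia.
Qed.

(** * The upper bound *)

Lemma minvdeg_occurs (F : cls) : 0 < nvar F ->
  exists2 v, v \in vars F & forall w, w \in vars F -> vdeg F v <= vdeg F w.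
Proof.
by case/minvdeg_attained=> v vF e; exists v => // w /minvdeg_le; rewrite e.
Qed.

(** Over a single variable, the only clause containing [x] is the unit clause. *)
Lemma ld_le1 (F : cls) x : wf_cls F -> vars F = [fset x.1] -> ld F x <= 1.
Proof.
move=> wf vF; rewrite /ld -(cardfs1 [fset x]); apply/fsubset_leq_card/fsubsetP => C.
rewrite !inE => /andP[CF xC]; apply/eqP/fsetP => y; rewrite inE.
apply/idP/eqP => [yC|-> //].
have : y.1 \in vars F by apply/varsP; exists C => //; exists y.2; case: y yC.
rewrite vF inE => /eqP/eq_var_compl[//|e].
by have := wf C CF x xC; rewrite -e yC.
Qed.

(** Both claims go through one induction: positive deficiency after an assignment bounds the literal
    degree, as the degree bound requires, and makes the truncated subtraction exact. *)
Lemma MU_low_degree n (F : cls) : MU F -> nvar F = n ->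
  n < ncl F /\ (0 < n -> exists2 v, v \in vars F & vdeg F v <= N (ncl F - n)).
Proof.
elim: n F => [|n IH] F MF nF.
  split=> //; rewrite lt0n cardfs_eq0; apply/eqP => F0.
  by case: MF => _ [[]]; exists xpredT => C; rewrite F0.
have [F' [MF' satF vF <- dF]] := MU_saturate MF.
have nF' : nvar F' = n.+1 by rewrite /nvar vF.
have [|v vF' minv] := @minvdeg_occurs F'; first by rewrite nF'.
have split x : x.1 = v -> n < ncl F' - ld F' x /\ (0 < n ->
    exists2 w, w \in vars F & vdeg F w <= N (ncl F' - ld F' x - n) + ld F' x).
  move=> xv; have xF : x.1 \in vars F' by rewrite xv.
  have vG : vars (assign F' x) = vars F' `\ x.1 by apply: assign_vars; rewrite ?xv.
  have nG : nvar (assign F' x) = n.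
    by apply/eqP; rewrite -eqSS -nF' /nvar vG [X in _ == X](cardfsD1 x.1) xF.
  have cG := assign_ncl x MF'.
  have [lt ex] := IH _ (assign_MU MF' xF satF) nG.
  have -> : ncl F' - ld F' x = ncl (assign F' x) by lia.
  split=> // /ex[w]; rewrite vG in_fsetD1 => /andP[neq wF] dw.
  exists w; first by rewrite -vF.
  apply: leq_trans (dF w) _; apply: leq_trans (assign_vdeg MF' neq) _.
  by rewrite leq_add2r.
(* Here [x] is the literal of [v] with the larger degree, the index [i] of the recursion. *)
have low x : x.1 = v -> ld F' (compl x) <= ld F' x ->
    exists2 w, w \in vars F & vdeg F w <= N (ncl F' - n.+1).
  move=> xv le; have [lt ex] := split x xv.
  have dv : vdeg F v <= 2 * ld F' x.
    by apply: leq_trans (dF v) _; rewrite -xv vdegE mul2n -addnn leq_add2l.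
  have [x1|x2] := leqP (ld F' x) 1.
    exists v; first by rewrite -vF.
    by apply: leq_trans (N_ge2 _); lia.
  (* A literal degree of at least 2 forces a second variable, so one remains after the
     assignment. *)
  have n0 : 0 < n.
    rewrite lt0n; apply: contraL x2 => /eqP n0; rewrite -leqNgt.
    apply: ld_le1; first exact: (proj1 MF').
    apply/eqP; rewrite eq_sym eqEfcard fsub1set xv vF' cardfs1.
    by rewrite -/(nvar F') nF' n0.
  have [w wF dw] := ex n0.
  have N' : minn (2 * ld F' x) (N (ncl F' - ld F' x - n) + ld F' x) <= N (ncl F' - n.+1).
    (* The deficiency after the assignment is [k - i + 1], and [lt] says that [i] is at most [k]. *)
    rewrite (_ : ncl F' - ld F' x - n = ncl F' - n.+1 - ld F' x + 1); last by lia.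
    by apply: N_ge; lia.
  move: N'; rewrite geq_min => /orP[h|h]; [exists v|exists w] => //.
  - by rewrite -vF.
  - exact: leq_trans dv h.
  - exact: leq_trans dw h.
split=> [|_].
  have [lt _] := split (v, true) (erefl _).
  by have := @vars_ld_gt0 _ (v, true) MF' vF'; lia.
have [le|/ltnW le] := leqP (ld F' (compl (v, true))) (ld F' (v, true)).
  exact: (low (v, true)).
exact: (low (compl (v, true))).
Qed.

Lemma MU_minvdeg_le (F : cls) k :
  MU F -> delta F = Posz k -> 0 < nvar F -> minvdeg F <= N k.
Proof.
move=> MF dF n0; have [lt /(_ n0)[v vF dv]] := MU_low_degree MF (erefl _).
apply: leq_trans (minvdeg_le vF) _.
by have <- : ncl F - nvar F = k by move: dF; rewrite /delta; lia.
Qed.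

(** * Hitting clause-sets given by lists *)

Definition clash (l m : seq lit) := has (fun x => compl x \in m) l.

Definition fset_clause (l : seq lit) : clause := [fset x in l].

Definition fset_cls (s : seq (seq lit)) : cls := [fset C in map fset_clause s].

Definition seq_vars (s : seq (seq lit)) : seq nat := undup [seq x.1 | x <- flatten s].

Section ExplicitHitting.
Variable s : seq (seq lit).
Hypothesis us : uniq s.
(** On the diagonal this says that no clause has a complementary pair, off it that distinct clauses
    clash. *)
Hypothesis hit : all (fun l => all (fun m => clash l m == (l != m)) s) s.

Lemma clashE l m : l \in s -> m \in s -> clash l m = (l != m).
Proof. by move=> /(allP hit)/allP /[apply] /eqP. Qed.

Lemma fset_clsP C : reflect (exists2 l, l \in s & C = fset_clause l) (C \in fset_cls s).
Proof. by rewrite inE; apply: mapP. Qed.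

(** Distinct lists clash; with equal literal sets, [l] would clash with itself. *)
Lemma fset_clause_inj : {in s &, injective fset_clause}.
Proof.
move=> l m ls ms /fsetP e; apply/eqP; rewrite -[_ == _]negbK -clashE //.
have := clashE ls ls; rewrite eqxx => /negbT; apply: contra => /hasP[x xl xm].
by apply/hasP; exists x => //; have := e (compl x); rewrite !inE xm.
Qed.

Lemma perm_fset_cls : perm_eq (fset_cls s) (map fset_clause s).
Proof.
apply: uniq_perm; rewrite ?fset_uniq ?map_inj_in_uniq //; first exact: fset_clause_inj.
by move=> C; rewrite inE.
Qed.

Lemma fset_cls_ld x : ld (fset_cls s) x = count (fun l => x \in l) s.
Proof.
rewrite ld_sum (perm_big _ perm_fset_cls) big_map -sum1_count [RHS]big_mkcond.
by apply: eq_bigr => l _; rewrite inE; case: ifP.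
Qed.

Lemma fset_cls_vars : vars (fset_cls s) = [fset v in seq_vars s].
Proof.
apply/fsetP=> v; rewrite inE mem_undup; apply/varsP/mapP.
  case=> C /fset_clsP[l ls ->] [b]; rewrite inE => vl.
  by exists (v, b) => //; apply/flattenP; exists l.
case=> -[w b] /flattenP[l ls wl] /= ->; exists (fset_clause l).
  by apply/fset_clsP; exists l.
by exists b; rewrite inE.
Qed.

Lemma fset_cls_nvar : nvar (fset_cls s) = size (seq_vars s).
Proof. by rewrite /nvar fset_cls_vars card_fseq undup_id ?undup_uniq. Qed.

Lemma fset_cls_UHIT :
  (forall phi : nat -> bool, ~~ all (has (fun x => phi x.1 == x.2)) s) ->
  UHIT (fset_cls s).
Proof.
move=> unsat; split; last split.
- move=> C /fset_clsP[l ls ->] x; rewrite !inE => xl.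
  have := clashE ls ls; rewrite eqxx => /negbT; apply: contra => xl'.
  by apply/hasP; exists x.
- case=> phi sat; case/negP: (unsat phi); apply/allP=> l ls.
  have /sat/sat_clauseP[x] : fset_clause l \in fset_cls s by apply/fset_clsP; exists l.
  by rewrite inE => xl e; apply/hasP; exists x; rewrite ?e.
move=> C D /fset_clsP[l ls ->] /fset_clsP[m ms ->] neq.
have : clash l m by rewrite clashE //; apply: contraNneq neq => ->.
by case/hasP=> x xl xm; exists x; rewrite inE.
Qed.

Lemma fset_cls_minvdeg m : 0 < size (seq_vars s) ->
  all (fun v => m <= count (fun l => (v, true) \in l) s
                     + count (fun l => (v, false) \in l) s) (seq_vars s) ->
  m <= minvdeg (fset_cls s).
Proof.
rewrite -fset_cls_nvar => /minvdeg_attained[v + ->] /allP min.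
by rewrite fset_cls_vars inE /vdeg !fset_cls_ld => /min.
Qed.

End ExplicitHitting.

(** * Witnesses for the lower bound *)

Definition clause3 (a b c : bool) : seq lit := [:: (0, a); (1, b); (2, c)].

(** A clause stands for the subcube of assignments falsifying it. Cases 3 and 4 split the 3-cube
    into vertices and two or one edges. For 3 the edges have different directions, as parallel ones
    would lower a degree to 4. The last case serves [k = 5]. *)
Definition hitting_witness (k : nat) : seq (seq lit) :=
  match k with
  | 1 => [:: [:: (0, true)]; [:: (0, false)]]
  | 2 => [:: [:: (0, true); (1, true)]; [:: (0, true); (1, false)];
             [:: (0, false); (1, true)]; [:: (0, false); (1, false)]]
  | 3 => [:: [:: (0, true); (1, true)]; [:: (1, false); (2, false)];
             clause3 true false true; clause3 false true true;
             clause3 false true false; clause3 false false true]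
  | 4 => [:: [:: (0, true); (1, true)];
             clause3 true false true; clause3 true false false;
             clause3 false true true; clause3 false true false;
             clause3 false false true; clause3 false false false]
  | _ => [:: clause3 true true true; clause3 true true false;
             clause3 true false true; clause3 true false false;
             clause3 false true true; clause3 false true false;
             clause3 false false true; clause3 false false false]
  end.

Lemma N_small : [/\ N 1 = 2, N 2 = 4, N 3 = 5, N 4 = 6 & N 5 = 8].
Proof. by rewrite /N /= unlock. Qed.

Lemma hitting_witness_unsat k (phi : nat -> bool) : 1 <= k <= 5 ->
  ~~ all (has (fun x => phi x.1 == x.2)) (hitting_witness k).
Proof.
by case: k => [|[|[|[|[|[|k]]]]]] // _ /=;
  case: (phi 0); case: (phi 1); case: (phi 2).
Qed.

Lemma hitting_witnessP k : 1 <= k <= 5 ->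
  exists F, [/\ UHIT F, delta F = Posz k, 0 < nvar F & N k <= minvdeg F].
Proof.
move=> k5; pose s := hitting_witness k.
(* All five conditions are settled by evaluation; the third expresses deficiency [k] without
   subtraction. *)
have /and5P[us hit /eqP cs n0 deg] :
  [&& uniq s, all (fun l => all (fun m => clash l m == (l != m)) s) s,
    size s == k + size (seq_vars s), 0 < size (seq_vars s)
  & all (fun v => N k <= count (fun l => (v, true) \in l) s
                     + count (fun l => (v, false) \in l) s) (seq_vars s)].
  rewrite {}/s; have [N1 N2 N3 N4 N5] := N_small.
  by case: k k5 => [|[|[|[|[|[|k]]]]]] // _; rewrite ?N1 ?N2 ?N3 ?N4 ?N5.
exists (fset_cls s); split.
- by apply: fset_cls_UHIT => // phi; apply: hitting_witness_unsat.
- rewrite /delta /ncl (perm_size (perm_fset_cls us hit)) size_map fset_cls_nvar //.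
  by rewrite cs; lia.
- by rewrite fset_cls_nvar.
- exact: fset_cls_minvdeg.
Qed.

Theorem theorem14p1 (k : nat) : 1 <= k <= 5 ->
  minvdeg_class_is (fun F => MU F /\ delta F = Posz k) (N k) /\
  minvdeg_class_is (fun F => UHIT F /\ delta F = Posz k) (N k).
Proof.
(* Since [UHIT] implies [MU], one upper bound and one witness serve both classes. *)
move=> k5; have [F [UF dF nF minF]] := hitting_witnessP k5.
split; split=> [m [G [[MG dG] [nG ->]]]|u ub].
- exact: MU_minvdeg_le.
- apply: leq_trans minF _; apply: ub; exists F.
  by split=> //; split=> //; apply: UHIT_MU.
- by apply: MU_minvdeg_le => //; apply: UHIT_MU.
- by apply: leq_trans minF _; apply: ub; exists F.
Qed.
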